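(* Let $G$ be a finite group and let $p$ be a prime. If $G$ is $p$-solvable of $p$-length $k$, then $d_{p'}(G)\le \big(2/(p+1)\big)^{k-1}$.
   Context: For a finite group $G$ and prime $p$, $k_{p'}(G)$ denotes the number of conjugacy classes of elements of $G$ whose order is not divisible by $p$, $|G|_{p'}$ is the largest divisor of $|G|$ coprime to $p$, and $d_{p'}(G)=k_{p'}(G)/|G|_{p'}$. $G$ is $p$-solvable if it has a normal series each of whose factors is a $p$-group or a group of order coprime to $p$; its $p$-length is the minimum number of factors that are $p$-groups among such normal series. *)

(* Defs.v *)
From mathcomp Require Import all_boot all_algebra all_fingroup all_solvable.
Set Implicit Arguments. Unset Strict Implicit. Unset Printing Implicit Defensive.
Import GRing.Theory Num.Theory.

Local Open Scope group_scope.

Definition normal_series (gT : finGroupType) (G : {group gT})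
    (n : nat) (S : nat -> {group gT}) : Prop :=
  [/\ S 0%N = 1%G :> {set gT}, S n = G :> {set gT} &
      forall i, (i < n)%N -> S i <| G /\ S i \subset S i.+1].

Definition p_series (p : nat) (gT : finGroupType) (G : {group gT})
    (n : nat) (S : nat -> {group gT}) : Prop :=
  normal_series G n S /\
  forall i, (i < n)%N -> p.-nat #|S i.+1 : S i| \/ p^'.-nat #|S i.+1 : S i|.

Definition num_p_factors (p : nat) (gT : finGroupType) (n : nat)
    (S : nat -> {group gT}) : nat :=
  #|[set i : 'I_n | p.-nat #|S i.+1 : S i| && (1 < #|S i.+1 : S i|)%N]|.

Definition p_solvable (p : nat) (gT : finGroupType) (G : {group gT}) : Prop :=
  exists n S, p_series p G n S.

Definition has_p_length (p : nat) (gT : finGroupType) (G : {group gT})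
    (k : nat) : Prop :=
  p_solvable p G /\
  (exists n S, p_series p G n S /\ num_p_factors p n S = k) /\
  (forall n S, p_series p G n S -> (k <= num_p_factors p n S)%N).

Definition k_p' (p : nat) (gT : finGroupType) (G : {group gT}) : nat :=
  #|[set xG in classes G | p^'.-elt (repr xG)]|.

Definition d_p' (p : nat) (gT : finGroupType) (G : {group gT}) : rat :=
  ((k_p' p G)%:R / (#|G|`_p^')%:R)%R.

(* Main.v *)
Require Import Defs.
From mathcomp Require Import all_boot all_algebra all_fingroup all_solvable.
From mathcomp Require Import all_order zify.
Set Implicit Arguments. Unset Strict Implicit.
Unset Printing Implicit Defensive.
Import Order.TTheory GRing.Theory Num.Theory.
Local Open Scope group_scope.

(**
The invariant d_p' is submultiplicative: d_p'(G) <= d_p'(N) d_p'(G / N) for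
every normal subgroup N.  By Burnside counting, this reduces to an injection
from the commuting pairs (x, n) with x a p'-element of a coset N g and n in N
to the commuting pairs with x in N g and n a p'-element of N.

If M is a normal p'-subgroup of N, N / M is a p-group and a Sylow p-subgroup P
of N does not centralise M, then |M : C_M(P)| > 1 is congruent to 1 modulo p, so
it is at least p + 1.  As the nontrivial P-orbits on M have at least p elements,
there are at most 2 |M| / (p + 1) orbits, whence d_p'(N) <= 2 / (p + 1).

When O_p(G) = 1 this applies to every nontrivial step O_p' < O_p'p of the upper
p'p-series, so each p-factor contributes a factor 2 / (p + 1).  In general only
the first p-factor O_p(G) is lost, which gives the exponent k - 1.
*)

(** * Counting p'-classes through commuting pairs *)

Section ClassCounting.
Variables (gT : finGroupType) (p : nat).
Implicit Types (G H N M P : {group gT}) (A : {set gT}).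

Definition pprime_elts A := [set x in A | p^'.-elt x].

(** Burnside's orbit count: the points of [A] fixed under conjugation by [x] are those commuting
    with [x]. *)
Lemma card_classes_mul H A : H \subset 'N(A) ->
  (#|class^~ H @: A| * #|H| = \sum_(x in H) #|'C_A[x]|)%N.
Proof.
move=> nAH; have actsA : [acts H, on A | 'J] by rewrite astabsJ.
rewrite -[LHS](Frobenius_Cauchy actsA); apply: eq_bigr => x _.
congr #|pred_of_set _|; apply/setP=> y; rewrite !in_setI; congr (_ && _).
apply/afix1P/cent1P => /= [/conjg_fixP/commgP // | cyx].
exact/conjg_fixP/commgP.
Qed.

Lemma k_p'E G : k_p' p G = #|class^~ G @: pprime_elts G|.
Proof.
congr #|pred_of_set _|; apply/setP=> xG; rewrite inE; apply/andP/imsetP.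
  case=> /imsetP[x Gx ->{xG}] p'x.
  exists (repr (x ^: G)); last first.
    by apply/class_eqP; rewrite class_sym; apply: mem_repr (class_refl _ _).
  rewrite inE p'x andbT; have [z Gz ->] := repr_class G x.
  by rewrite groupJ.
case=> x; rewrite inE => /andP[Gx p'x] ->{xG}; rewrite mem_classes //.
by have [z Gz ->] := repr_class G x; rewrite p_eltJ.
Qed.

Lemma pprime_elts_norm H A : H \subset 'N(A) -> H \subset 'N(pprime_elts A).
Proof.
move/subsetP=> nAH; apply/subsetP=> x Hx; rewrite inE.
apply/subsetP=> _ /imsetP[y + ->].
by rewrite !inE p_eltJ memJ_norm ?nAH.
Qed.

(** Burnside's count groups commuting pairs by an arbitrary element of [N]; exchanging the sums
    regroups them by their p'-element. *)
Lemma k_p'_mul_card N :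
  (k_p' p N * #|N| = \sum_(x in pprime_elts N) #|'C_N[x]|)%N.
Proof.
rewrite k_p'E card_classes_mul ?pprime_elts_norm ?normG //.
under eq_bigr do rewrite -sum1_card.
under [RHS]eq_bigr do rewrite -sum1_card.
rewrite (exchange_big_dep (mem (pprime_elts N))) /=; last first.
  by move=> x y _ /setIP[].
apply: eq_bigr => x Ex; apply: eq_bigl => y.
by rewrite !in_setI Ex cent1C.
Qed.

(* The injection maps (x, n) to (n_p x, n_p'); since x is a p'-element commuting
   with n, both n_p and x are recovered from n_p x as its p- and p'-parts. *)
Lemma card_rcoset_pprime_classes N (g : gT) : g \in 'N(N) ->
  #|class^~ N @: pprime_elts (N :* g)| <= k_p' p N.
Proof.
move=> nNg; rewrite -(leq_pmul2r (cardG_gt0 N)) k_p'_mul_card.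
rewrite card_classes_mul; last first.
  apply: pprime_elts_norm; apply/subsetP=> x Nx; rewrite inE.
  apply/subsetP=> _ /imsetP[_ /rcosetP[n Nn ->] ->].
  have -> : (n * g) ^ x = x^-1 * n * x ^ g^-1 * g.
    by rewrite !conjgE invgK !mulgA mulgKV.
  by rewrite mem_rcoset mulgK groupM ?memJ_norm ?groupV // groupM ?groupV.
(* If some x in [N :* g] commutes with n, all such elements lie in the coset ['C_N[n] :* x]. Hence
   it suffices to inject into pairs with an entry in [N :* g]. *)
have leC n : #|'C_(N :* g)[n]| <= #|'C_N[n]|.
  have [->|[x /setIP[Ngx cxn]]] := set_0Vmem 'C_(N :* g)[n].
    by rewrite cards0.
  rewrite -(card_rcoset 'C_N[n] x) subset_leq_card //; apply/subsetP=> y.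
  case/setIP=> Ngy cyn; rewrite mem_rcoset in_setI.
  by rewrite -mem_rcoset (rcoset_eqP Ngx) in Ngy *; rewrite Ngy groupM ?groupV.
apply: leq_trans (leq_sum _ (fun n _ => leC n)).
have sumT A (B : gT -> {set gT}) :
  \sum_(n in A) #|B n| = #|[set u : gT * gT | (u.1 \in A) && (u.2 \in B u.1)]|.
  under eq_bigr do rewrite -sum1_card.
  by rewrite pair_big_dep /= -sum1_card; apply: eq_bigl => u; rewrite inE.
rewrite !sumT; pose f (u : gT * gT) := (u.1.`_p^', u.1.`_p * u.2).
rewrite -(card_in_imset (f := f)).
  apply: subset_leq_card; apply/subsetP=> _ /imsetP[[n x] + ->].
  rewrite inE => /andP[/= Nn /setIP[/setIdP[Ngx p'x] /cent1P cxn]].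
  rewrite inE; apply/andP; split; first by rewrite inE /= groupX ?p_elt_constt.
  apply/setIP; split=> /=.
    by rewrite mem_rcoset -mulgA groupM ?groupX -?mem_rcoset.
  apply/cent1P/commute_sym/commuteM; first by apply: commuteX2.
  by apply/commute_sym/commuteX.
move=> [n x] [m y]; rewrite inE => /andP[_ /setIP[/setIdP[_ p'x] /cent1P cxn]].
rewrite inE => /andP[_ /setIP[/setIdP[_ p'y] /cent1P cym]] [eqp' eqx].
have sep (a b : gT) : commute b a -> p^'.-elt b ->
  (a.`_p * b).`_p = a.`_p /\ (a.`_p * b).`_p^' = b.
  move=> cba p'b; have c : commute a.`_p b by apply/commute_sym/commuteX.
  split; rewrite consttM //.
    by rewrite (constt1P p'b) mulg1 constt_p_elt ?p_elt_constt.
  rewrite (constt_p_elt p'b) (_ : _.`_p^' = 1) ?mul1g //; apply/constt1P.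
  by rewrite p_eltNK p_elt_constt.
have [n1 n2] := sep n x cxn p'x; have [m1 m2] := sep m y cym p'y.
have exy : x = y by rewrite -n2 eqx m2.
have enm : n.`_p = m.`_p by rewrite -n1 eqx m1.
by congr (_, _) => //; rewrite -(consttC p n) enm eqp' consttC.
Qed.
End ClassCounting.

(** * Submultiplicativity over a normal subgroup *)

(** Send each p'-class of [G] to the class of its image in [G / N]. Every class in the fibre over
    the class of N g meets N g in p'-elements, so the fibre is no larger than the set of [N]-classes
    of those elements, which the coset bound controls. *)
Lemma leq_k_p'_quotient (gT : finGroupType) (p : nat) (G N : {group gT}) :
  N <| G -> k_p' p G <= k_p' p N * k_p' p (G / N).
Proof.
move=> nsNG; have [sNG nNG] := andP nsNG.
pose K := [set xG in classes G | p^'.-elt (repr xG)].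
pose f (xG : {set gT}) := coset N (repr xG) ^: (G / N).
have Kf xG : xG \in K -> f xG \in class^~ (G / N) @: pprime_elts p (G / N).
  rewrite inE => /andP[/imsetP[x Gx ->{xG}] p'x].
  have Gr : repr (x ^: G) \in G.
    by have [z Gz ->] := repr_class G x; rewrite groupJ.
  by apply: imset_f; rewrite inE mem_quotient ?morph_p_elt ?(subsetP nNG).
rewrite [k_p' p (G / N)]k_p'E mulnC -[k_p' p G]sum1_card.
rewrite -[X in (X * _)%N]sum1_card.
rewrite (partition_big f (mem (class^~ (G / N) @: pprime_elts p (G / N)))) //=.
rewrite big_distrl /=; apply: leq_sum => _ /imsetP[gN + ->].
rewrite inE mul1n => /andP[/morphimP[g nNg Gg ->{gN}] _].
apply: leq_trans (card_rcoset_pprime_classes p nNg).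
rewrite sum1dep_card.
apply: leq_trans (leq_imset_card (fun c : {set gT} => repr c ^: G) _).
apply: subset_leq_card; apply/subsetP=> xG.
rewrite !inE => /andP[/andP[/imsetP[x Gx ->{xG}] p'x] /eqP].
rewrite /f => /esym/class_eqP.
case: (repr_class G x) p'x => z Gz -> p'x.
case/imsetP=> _ /morphimP[y nNy Gy ->].
have nNx : x ^ z \in 'N(N) by rewrite (subsetP nNG) ?groupJ.
move=> def_g; pose w := (x ^ z) ^ y.
have Ngw : w \in N :* g.
  have nNw : w \in 'N(N) := groupJ nNx nNy.
  apply/(rcoset_kercosetP nNw nNg).
  by rewrite [RHS]def_g /w morphJ.
apply/imsetP; exists (w ^: N); last first.
  have [t Nt ->] := repr_class N w.
  by rewrite !classGidl // (subsetP sNG).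
by apply: imset_f; rewrite inE Ngw p_eltJ.
Qed.

Lemma d_p'_ge0 (p : nat) (gT : finGroupType) (G : {group gT}) :
  (0 <= d_p' p G)%R.
Proof. by rewrite divr_ge0 ?ler0n. Qed.

Lemma d_p'_quotient_le (p : nat) (gT : finGroupType) (G N : {group gT}) :
  N <| G -> (d_p' p G <= d_p' p N * d_p' p (G / N))%R.
Proof.
move=> nsNG; rewrite /d_p' mulf_div -!natrM -partnM ?cardG_gt0 //.
rewrite card_quotient ?normal_norm // Lagrange ?normal_sub //.
by rewrite ler_wpM2r ?invr_ge0 ?ler0n // ler_nat leq_k_p'_quotient.
Qed.

(** * Bounds for p-groups, p'-groups and p'-by-p groups *)

Section SmallCases.
Variables (p : nat) (gT : finGroupType).
Implicit Types G N M P : {group gT}.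

Lemma d_p'_le G (a b : nat) :
  (0 < b)%N -> (k_p' p G * b <= a * #|G|`_p^')%N -> (d_p' p G <= a%:R / b%:R)%R.
Proof.
move=> b_gt0 le_ab.
rewrite ler_pdivrMr ?ltr0n ?part_gt0 // mulrAC ler_pdivlMr ?ltr0n //.
by rewrite -!natrM ler_nat.
Qed.

Lemma d_p'_le1_of_card G :
  (#|pprime_elts p G| <= #|G|`_p^')%N -> (d_p' p G <= 1)%R.
Proof.
move=> le_E; rewrite -[1%R]divr1; apply: (@d_p'_le _ 1 1) => //.
by rewrite muln1 mul1n k_p'E (leq_trans (leq_imset_card _ _)).
Qed.

Lemma pgroup_d_p'_le1 G : p.-group G -> (d_p' p G <= 1)%R.
Proof.
move=> pG; apply: d_p'_le1_of_card.
apply: leq_trans (part_gt0 _ _); rewrite -(cards1 (1 : gT)).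
apply: subset_leq_card; apply/subsetP=> x /setIdP[Gx p'x].
by rewrite inE -order_eq1 (pnat_1 (mem_p_elt pG Gx) p'x).
Qed.

Lemma p'group_d_p'_le1 G : p^'.-group G -> (d_p' p G <= 1)%R.
Proof.
move=> p'G; apply: d_p'_le1_of_card; rewrite part_pnat_id //.
by apply: subset_leq_card; apply/subsetP=> x /setIdP[].
Qed.

Hypothesis p_pr : prime p.

Lemma leq_mul_card_cent_pgroup M P :
  p^'.-group M -> p.-group P -> P \subset 'N(M) -> ~~ (P \subset 'C(M)) ->
  (p.+1 * #|'C_M(P)| <= #|M|)%N.
Proof.
move=> p'M pP nMP ncMP.
have actsM : [acts P, on M | 'J] by rewrite astabsJ.
have /eqP := pgroup_fix_mod pP actsM; rewrite afixJ.
have sCM := subsetIl M 'C(P); rewrite -(Lagrange sCM).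
set c := #|'C_M(P)|; set j := #|M : _|.
have j_gt1 : (1 < j)%N by rewrite indexg_gt1 subsetI subxx centsC.
have p'c : coprime p c.
  by rewrite prime_coprime // -p'natE //; apply: pgroupS sCM p'M.
have le_c : (c <= c * j)%N by rewrite leq_pmulr // ltnW.
(* The fixed-point congruence says that p divides c (j - 1); since p is coprime to c and j > 1, this
   forces j >= p + 1. *)
rewrite (eqn_mod_dvd _ le_c) -[X in (_ - X)%N]muln1 -mulnBr Gauss_dvdr //.
move/dvdn_leq; rewrite subn_gt0 j_gt1 => /(_ isT) le_pj.
by rewrite mulnC leq_mul2l; apply/orP; right; lia.
Qed.

(** Orbit sizes are powers of [p], so an orbit c has p <= |c|, or p = |c| + (p - 1) when it is a
    single point of ['C_M(P)]. Sum over all orbits. *)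
Lemma leq_mul_card_class_pgroup M P :
  p.-group P -> P \subset 'N(M) ->
  (p * #|class^~ P @: M| <= #|M| + p.-1 * #|'C_M(P)|)%N.
Proof.
move=> pP nMP; have actsM : [acts P, on M | 'J] by rewrite astabsJ.
have sumM : (\sum_(c in class^~ P @: M) #|c| = #|M|)%N.
  exact: acts_sum_card_orbit actsM.
have leC : (#|[set c in class^~ P @: M | #|c| == 1%N]| <= #|'C_M(P)|)%N.
  apply: leq_trans (leq_imset_card (@set1 gT) _); apply: subset_leq_card.
  apply/subsetP=> _ /setIdP[/imsetP[x Mx ->] /cards1P[y def_xP]].
  have /set1P exy : x \in [set y] by rewrite -def_xP class_refl.
  rewrite def_xP -exy; apply: imset_f; rewrite in_setI Mx; apply/centP=> z Pz.
  apply/commgP/conjg_fixP/set1P; rewrite exy -def_xP -exy.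
  exact: memJ_class.
rewrite -sumM; apply: leq_trans (leq_add (leqnn _) (leq_mul (leqnn p.-1) leC)).
rewrite -sum1_card big_distrr -[X in (_ * X)%N]sum1_card /= big_distrr /=.
under [X in (_ + X)%N]eq_bigl do rewrite inE.
rewrite big_mkcondr -big_split /=; apply: leq_sum => _ /imsetP[x Mx ->].
have p_xP : p.-nat #|x ^: P|.
  by rewrite -index_cent1; apply: pnat_dvd (dvdn_indexg _ _) pP.
have [-> | ntxP] := eqVneq #|x ^: P| 1%N.
  by rewrite !muln1 add1n prednK ?prime_gt0.
rewrite muln1 addn0; have /p_natP[[|e] def_xP] := p_xP;
  rewrite def_xP // in ntxP *.
by rewrite expnS -{1}[p]muln1 leq_mul2l expn_gt0 prime_gt0 ?orbT.
Qed.

(** As [N / M] is a p-group, all p'-elements of [N] lie in [M], so distinct p'-classes of [N]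
    contain distinct [P]-orbits on [M]. *)
Lemma d_p'_le_noncentral N M P :
  M <| N -> p^'.-group M -> p.-nat #|N : M| -> p.-Sylow(N) P ->
  ~~ (P \subset 'C(M)) -> (d_p' p N <= 2%:R / p.+1%:R)%R.
Proof.
move=> nsMN p'M pNM sylP ncMP; apply: d_p'_le => //.
have [sMN nMN] := andP nsMN; have [sPN pP _] := and3P sylP.
have nMP := subset_trans sPN nMN.
have -> : (#|N|`_p^' = #|M|)%N.
  rewrite -(Lagrange sMN) partnM // part_pnat_id // part_p'nat ?muln1 //.
  by rewrite pnatNK.
have leC := leq_mul_card_cent_pgroup p'M pP nMP ncMP.
have leO := leq_mul_card_class_pgroup pP nMP.
have le_k : (k_p' p N <= #|class^~ P @: M|)%N.
  rewrite k_p'E.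
  apply: leq_trans (leq_imset_card (fun c : {set gT} => repr c ^: N) _).
  apply: subset_leq_card; apply/subsetP=> _ /imsetP[x /setIdP[Nx p'x] ->].
  have Mx : x \in M.
    have: coset M x \in (N / M) by rewrite mem_quotient.
    move/(mem_p_elt (pi := p)); rewrite /pgroup card_quotient // => /(_ pNM) px.
    have /(pnat_1 px)/eqP :=
      morph_p_elt (coset_morphism M) (subsetP nMN x Nx) p'x.
    by rewrite order_eq1 => /eqP/coset_idr -> //; apply: subsetP nMN x Nx.
  apply/imsetP; exists (x ^: P); first exact: imset_f.
  by have [z Pz ->] := repr_class P x; rewrite classGidl // (subsetP sPN).
have p_gt0 := prime_gt0 p_pr.
move: leC leO le_k p_gt0; set C := #|'C_M(P)|.
set O := #|_ @: _|; set m := #|M|; set k := k_p' _ _.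
(* p (p + 1) O <= (p + 1) m + (p - 1) (p + 1) C <= (p + 1) m + (p - 1) m = 2 p m. *)
move=> leC leO le_k p_gt0; rewrite -(leq_pmul2l p_gt0).
apply: (@leq_trans (p * O * p.+1)); first by rewrite mulnA !leq_mul.
nia.
Qed.

End SmallCases.

(** * Series, p-length and quotients *)

(** A witness without minimality, which an induction can build; the minimality of [k] is compared
    with it only at the end. *)
Definition p_length_le (p : nat) (gT : finGroupType) (G : {group gT})
    (j : nat) :=
  exists n S, p_series p G n S /\ (num_p_factors p n S <= j)%N.

Lemma num_p_factorsE (p : nat) (gT : finGroupType) n (S : nat -> {group gT}) :
  (num_p_factors p n S =
    \sum_(i < n) (p.-nat #|S i.+1 : S i| && (1 < #|S i.+1 : S i|)))%N.
Proof.
rewrite /num_p_factors -sum1dep_card big_mkcond /=.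
by apply: eq_bigr => i _; case: (_ && _).
Qed.

Lemma p'group_p_length_le0 (p : nat) (gT : finGroupType) (G : {group gT}) :
  p^'.-group G -> p_length_le p G 0.
Proof.
move=> p'G; exists 1%N, (fun i => if i is 0%N then 1%G else G); split.
  split; last by case=> // _; right; rewrite indexg1.
  by split=> // -[] // _; rewrite normal1 sub1G.
rewrite num_p_factorsE big_ord1 indexg1; case: andP => // -[pG].
by rewrite (pnat_1 pG p'G).
Qed.

(** Pull a series of [G / N] back to [G], where it starts at [N], and prepend 1 and [M]. Only the
    step from [M] to [N] can add a p-factor. *)
Lemma p_length_leS (p : nat) (gT : finGroupType) (G N M : {group gT}) j :
  M <| G -> N <| G -> M \subset N -> p^'.-group M -> p.-nat #|N : M| ->
  p_length_le p (G / N) j -> p_length_le p G j.+1.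
Proof.
move=> nsMG nsNG sMN p'M pNM [n [S [[[S0 Sn nsS] facS] leS]]].
pose S' i := match i with
  | 0%N => 1%G | 1%N => M | i'.+2 => (coset N @*^-1 S i')%G end.
have S'2 : S' 2 = N :> {set gT} by rewrite /= S0 cosetpre1.
have idxS i : (#|S' i.+3 : S' i.+2| = #|S i.+1 : S i|)%N.
  by rewrite index_morphpre ?sub_im_coset.
have defG : coset N @*^-1 (G / N) = G by rewrite quotientGK.
exists n.+2, S'; split; first split; first split=> //.
- by rewrite /= Sn.
- case=> [|[|i]]; first by rewrite normal1 sub1G.
    by rewrite S'2.
  rewrite !ltnS => /nsS[nsSi sSi]; split; last by rewrite /= morphpreS.
  by rewrite -defG cosetpre_normal.
- case=> [|[|i]]; first by right; rewrite indexg1.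
    by left; rewrite S'2.
  by rewrite !ltnS idxS => /facS.
rewrite num_p_factorsE !big_ord_recl; rewrite num_p_factorsE in leS.
have -> : p.-nat #|S' 1%N : S' 0%N| && (1 < #|S' 1%N : S' 0%N|)%N = false.
  by rewrite indexg1; case: andP => // -[pM]; rewrite (pnat_1 pM p'M).
rewrite add0n -(add1n j) leq_add ?leq_b1 //.
by apply: leq_trans leS; apply: leq_sum => i _; rewrite idxS.
Qed.

Section PSolvable.
Variables (p : nat) (gT : finGroupType) (G : {group gT}).
Hypothesis psolG : p_solvable p G.

Lemma p_solvable_quotient (N : {group gT}) : N <| G -> p_solvable p (G / N).
Proof.
case/andP=> sNG nNG; case: psolG => n [S [[S0 Sn nsS] facS]].
exists n, (fun i => S i / N)%G; split.
  split=> [||i /nsS[nsSi sSi]] /=; rewrite ?S0 ?Sn ?quotient1 //.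
  by rewrite quotient_normal ?quotientS.
(* [normal_series] gives normality only below index [n], so the top term is treated apart. *)
move=> i lt_in; have sSG : S i.+1 \subset G.
  have [lt_Sin|] := ltnP i.+1 n; first by have [/normal_sub] := nsS _ lt_Sin.
  move=> le_n; rewrite (_ : i.+1 = n) ?Sn //.
  by apply/eqP; rewrite eqn_leq lt_in.
have dvd_idx : #|S i.+1 / N : S i / N| %| #|S i.+1 : S i|.
  by rewrite index_quotient // (subset_trans _ nNG) // subIset ?sSG.
by case: (facS i lt_in) => [pS|p'S]; [left|right]; apply: pnat_dvd dvd_idx _.
Qed.

(** The first nontrivial term of a series would be a normal p- or p'-subgroup, hence inside one of
    the two cores. *)
Lemma p_solvable_pcores_trivial : 'O_p(G) = 1 -> 'O_p^'(G) = 1 -> G :=: 1.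
Proof.
case: psolG => n [S [[S0 Sn nsS] facS]] Op1 Op'1; rewrite -Sn.
suff: forall i, (i <= n)%N -> S i :=: 1 by apply.
elim=> // i IHi lt_in; have Si1 := IHi (ltnW lt_in).
have nsSG : S i.+1 <| G.
  have [/nsS[] //|le_n] := ltnP i.+1 n.
  have e : i.+1 = n by apply/eqP; rewrite eqn_leq lt_in.
  by rewrite e (_ : S n = G) //; apply: val_inj.
apply/trivgP; have := facS i lt_in; rewrite Si1 indexg1.
by case=> piS; [rewrite -Op1 | rewrite -Op'1]; apply: pcore_max.
Qed.

End PSolvable.

(** * Induction along the upper p'p-series *)

Lemma d_p'_bound_pcore1 (p : nat) (gT : finGroupType) (G : {group gT}) :
  prime p -> p_solvable p G -> 'O_p(G) = 1 ->
  exists2 j, p_length_le p G j & (d_p' p G <= (2%:R / p.+1%:R) ^+ j)%R.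
Proof.
move=> p_pr; have [m] := ubnP #|G|.
elim: m gT G => // m IHm gT G; rewrite ltnS => leGm psolG Op1.
pose M := 'O_p^'(G)%G.
pose N := [group of pseries [:: p^' : nat_pred; p : nat_pred] G].
have nsMG : M <| G by apply: pcore_normal.
have nsNG : N <| G by apply: pseries_normal.
have p'M : p^'.-group M by apply: pcore_pgroup.
have defNM : N / M = 'O_p(G / M) by apply: quotient_pseries2.
have sMN : M \subset N.
  by rewrite /= -pseries1; apply: (pseries_sub_catl [:: _] [:: _]).
have nsMN : M <| N := normalS sMN (normal_sub nsNG) nsMG.
have pNM : p.-nat #|N : M|.
  by rewrite -card_quotient ?normal_norm // defNM; apply: pcore_pgroup.
have [P sylP] := Sylow_exists p N; have [sPN pP _] := and3P sylP.
(* If [P] centralises [M], then [P] is a normal Sylow subgroup of N = M P, hence normal in [G] and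
   trivial. Both cores of [G / M] then vanish, so [G] = [M] is a p'-group. *)
have [cMP | ncMP] := boolP (P \subset 'C(M)).
  have defN : M * P = N.
    apply/eqP; rewrite eqEcard mul_subG //= coprime_cardMg; last first.
      by rewrite coprime_sym (pnat_coprime pP p'M).
    rewrite (card_Hall sylP) -[X in (X <= _)%N](Lagrange sMN) leq_mul2l.
    rewrite -(Lagrange sMN) partnM // (part_pnat_id pNM).
    by rewrite leq_pmull ?orbT ?part_gt0.
  have nsPN : P <| N.
    by rewrite /normal sPN -defN mul_subG ?normG // cents_norm // centsC.
  have P1 : P :=: 1.
    apply/trivgP; rewrite -Op1 pcore_max //.
    by rewrite -(normal_Hall_pcore sylP nsPN) gFnormal_trans.
  have G1 : G / M = 1.
    apply: p_solvable_pcores_trivial (p_solvable_quotient psolG nsMG) _ _.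
      by rewrite -defNM -defN P1 mulg1 trivg_quotient.
    exact: trivg_pcore_quotient.
  have p'G : p^'.-group G.
    by apply: pgroupS p'M; rewrite -quotient_sub1 ?normal_norm // G1.
  exists 0%N; first exact: p'group_p_length_le0.
  by rewrite expr0 p'group_d_p'_le1.
have ltGN : (#|G / N| < m)%N.
  apply: leq_trans leGm; apply: ltn_quotient (normal_sub nsNG).
  by apply: contraNneq ncMP => N1; rewrite (subset_trans sPN) // N1 sub1G.
(* Adding another [p] after [p] does not enlarge the series, so the hypothesis passes to [G / N]. *)
have OpN1 : 'O_p(G / N) = 1.
  rewrite /= -(quotient_pseries [:: p^' : nat_pred; p : nat_pred]) /=.
  by rewrite (pseries_rcons_id [:: _]) trivg_quotient.
have [j lenj dj] := IHm _ _ ltGN (p_solvable_quotient psolG nsNG) OpN1.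
exists j.+1; first exact: p_length_leS nsMG nsNG sMN p'M pNM lenj.
apply: le_trans (d_p'_quotient_le p nsNG) _; rewrite exprS.
apply: ler_pM; rewrite ?d_p'_ge0 //.
exact: d_p'_le_noncentral p'M pNM sylP ncMP.
Qed.

Local Open Scope ring_scope.

Theorem theorem1p4 (gT : finGroupType) (G : {group gT}) (p k : nat) :
  prime p -> has_p_length p G k ->
  d_p' p G <= (2%:R / (p%:R + 1) : rat) ^ (k%:Z - 1).
Proof.
move=> p_pr [psolG [_ min_k]].
have nsOG : 'O_p(G) <| G := pcore_normal p G.
have [j len_j dj] :=
  d_p'_bound_pcore1 p_pr (p_solvable_quotient psolG nsOG)
    (trivg_pcore_quotient p G).
(* Prepend ['O_p(G)] to the series of the quotient, taking the trivial group as the p'-step. *)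
have le_kj : (k <= j.+1)%N.
  have pO : p.-nat #|'O_p(G) : 1%G| by rewrite indexg1; apply: pcore_pgroup.
  have [n [S [serS leS]]] :=
    p_length_leS (normal1 G) nsOG (sub1G _) (pgroup1 _ _) pO len_j.
  exact: leq_trans (min_k _ _ serS) leS.
have {}dj : d_p' p G <= (2%:R / p.+1%:R) ^+ j.
  apply: le_trans (d_p'_quotient_le p nsOG) _; rewrite -[leRHS]mul1r.
  by rewrite ler_pM ?d_p'_ge0 ?pgroup_d_p'_le1 ?pcore_pgroup.
rewrite natr1; set c := 2%:R / _ in dj *.
have c_gt0 : 0 < c by rewrite divr_gt0 ?ltr0n.
have c_le1 : c <= 1.
  by rewrite ler_pdivrMr ?ltr0n // mul1r ler_nat ltnS prime_gt0.
(* For [k] = 0 the integer exponent is -1, and c^j <= 1 <= c^-1. *)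
apply: le_trans dj _; case: k le_kj {min_k} => [|k] le_kj.
  rewrite sub0r exprN1; apply: le_trans (exprn_ile1 _ (ltW c_gt0) c_le1) _.
  by rewrite invf_ge1.
by rewrite -addn1 PoszD addrK ler_wiXn2l // ltW.
Qed.
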